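(* Let $\mathcal{P}$ be a CP program and $\mathcal{P}^{\mathit{rdw}}$ its associated random walk program. Then the termination times $T^{\mathcal{P}}$ and $T^{\mathcal{P}^{\mathit{rdw}}}$ are identically distributed with respect to $\mathit{rdw}_\mathcal{P}$: for all $\vec{x}_0 \in \mathbb{Z}^{r}$ with $x_0 = \mathit{rdw}_{\mathcal{P}}(\vec{x}_0)$ and all $j \in \mathbb{N}\cup\{\infty\}$ we have $\mathbb{P}_{\vec{x}_0}^{\mathcal{P}}(T^{\mathcal{P}} = j) = \mathbb{P}^{\mathcal{P}^{\mathit{rdw}}}_{x_0}(T^{\mathcal{P}^{\mathit{rdw}}} = j)$. In particular, $\mathbb{P}_{\vec{x}_0}^{\mathcal{P}}(T^{\mathcal{P}} < \infty) = \mathbb{P}^{\mathcal{P}^{\mathit{rdw}}}_{x_0}(T^{\mathcal{P}^{\mathit{rdw}}} < \infty)$ and $rt_{\vec{x}_0}^\mathcal{P} = \mathbb{E}^\mathcal{P}_{\vec{x}_0}(T^{\mathcal{P}}) = \mathbb{E}^{\mathcal{P}^{\mathit{rdw}}}_{x_0}(T^{\mathcal{P}^{\mathit{rdw}}}) = rt_{x_0}^{\mathcal{P}^{\mathit{rdw}}}$, i.e., the expected runtimes of $\mathcal{P}$ on input $\vec{x}_0$ and of $\mathcal{P}^{\mathit{rdw}}$ on input $x_0$ coincide.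
   Context: A CP (constant probability) program $\mathcal{P}$ has the form: while $(\vec{a}\bullet\vec{x} > b)$ $\{\vec{x} = \vec{x}+\vec{c}_1\ [p_{\vec{c}_1}]; \ldots; \vec{x}=\vec{x}+\vec{c}_n\ [p_{\vec{c}_n}]; \vec{x} = \vec{d}\ [p']\}$, where $\vec{x}=(x_1,\ldots,x_r)$ are integer program variables, $\vec{a},\vec{c}_1,\ldots,\vec{c}_n,\vec{d}\in\mathbb{Z}^r$ with the $\vec{c}_j$ pairwise distinct, $b\in\mathbb{Z}$, $\bullet$ is the scalar product, $\vec{a}\bullet\vec{d}\le b$, and the constants $p_{\vec{c}_j},p'\ge 0$ sum to $1$; in each loop iteration exactly one of the updates is chosen with the given probability. Define the affine map $\mathit{rdw}_\mathcal{P}:\mathbb{Z}^r\to\mathbb{Z}$, $\mathit{rdw}_\mathcal{P}(\vec{z}) = \vec{a}\bullet\vec{z} - b$ (so $\mathit{rdw}_\mathcal{P}(\vec{d})\le 0$). Let $k_\mathcal{P},m_\mathcal{P}\in\mathbb{N}$ be minimal with $-k_\mathcal{P}\le \vec{a}\bullet\vec{c}_j\le m_\mathcal{P}$ for all $j$, and for $-k_\mathcal{P}\le j\le m_\mathcal{P}$ let $p^{\mathit{rdw}}_j = \sum_{1\le u\le n,\ \vec{a}\bullet\vec{c}_u = j} p_{\vec{c}_u}$. The random walk program $\mathcal{P}^{\mathit{rdw}}$ is: while $(x>0)$ $\{x = x+j\ [p^{\mathit{rdw}}_j]$ for $-k_\mathcal{P}\le j\le m_\mathcal{P}$; $x = \mathit{rdw}_\mathcal{P}(\vec{d})\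 [p']\}$, with a single integer variable $x$. For a program and initial value $\vec{x}_0$, $\mathbb{P}^{\mathcal{P}}_{\vec{x}_0}$ is the probability measure on infinite sequences of program states (runs) induced by the program started in $\vec{x}_0$ (standard cylinder-set construction; once a state violates the loop guard, it stays there with probability 1). The termination time $T^{\mathcal{P}}$ maps a run to the first index of a state violating the loop guard (or $\infty$). The expected runtime $rt^{\mathcal{P}}_{\vec{x}_0} = \mathbb{E}^{\mathcal{P}}_{\vec{x}_0}(T^{\mathcal{P}})$ is the expected number of loop iterations (defined as $\infty$ if termination does not occur with probability 1). *)

(* Defs.v *)
From HB Require Import structures.
From mathcomp Require Import all_boot all_order all_algebra.
From mathcomp Require Import ring lra.
From mathcomp Require Import all_classical all_reals all_analysis.

Set Implicit Arguments.
Unset Strict Implicit.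
Unset Printing Implicit Defensive.

Import Order.TTheory GRing.Theory Num.Theory.

Local Open Scope classical_set_scope.
Local Open Scope ring_scope.

Definition sprod (r : nat) (u v : 'rV[int]_r) : int := \sum_(i < r) u 0 i * v 0 i.

(* while (a . x > b) { x = x + c_j [p_j] (j < n); x = d [p'] } *)
Record cp_program (R : realType) (r n : nat) := CPProgram {
  cp_a : 'rV[int]_r;
  cp_b : int;
  cp_c : 'I_n -> 'rV[int]_r;
  cp_d : 'rV[int]_r;
  cp_p : 'I_n -> R;
  cp_p' : R;
  cp_c_inj : injective cp_c;
  cp_d_exit : sprod cp_a cp_d <= cp_b;
  cp_p_ge0 : forall j, 0 <= cp_p j;
  cp_p'_ge0 : 0 <= cp_p';
  cp_p_sum1 : \sum_(j < n) cp_p j + cp_p' = 1 }.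

Definition guard (R : realType) (r n : nat) (P : cp_program R r n)
  (z : 'rV[int]_r) : bool := sprod (cp_a P) z > cp_b P.

Definition trans (R : realType) (r n : nat) (P : cp_program R r n)
    (z z' : 'rV[int]_r) : R :=
  if guard P z then
    \sum_(j < n | z' == z + cp_c P j) cp_p P j + (z' == cp_d P)%:R * cp_p' P
  else (z' == z)%:R.

Definition run (r : nat) := nat -> 'rV[int]_r.

HB.instance Definition _ r := Choice.on (run r).
HB.instance Definition _ r := isPointed.Build (run r) (fun=> 0).

Definition cylinder (r : nat) (s : seq 'rV[int]_r) : set (run r) :=
  [set w | mkseq w (size s) = s].

Definition cylinders (r : nat) : set (set (run r)) := range (@cylinder r).

Definition runs (r : nat) := g_sigma_algebraType (@cylinders r).

HB.instance Definition _ r := Measurable.on (runs r).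

Fixpoint path_prob (R : realType) (r n : nat) (P : cp_program R r n)
    (z : 'rV[int]_r) (s : seq 'rV[int]_r) : R :=
  if s is z' :: s' then trans P z z' * path_prob P z' s' else 1.

Definition induced (R : realType) (r n : nat) (P : cp_program R r n)
    (x0 : 'rV[int]_r) (mu : probability (runs r) R) : Prop :=
  forall (z : 'rV[int]_r) (s : seq 'rV[int]_r),
    mu (cylinder (z :: s)) = ((z == x0)%:R * path_prob P z s)%:E.

(* Existence of the induced measure: Lebesgue measure on [0, 1[ is pushed       *)
(* forward along the map that reads off the successive random choices from a    *)
(* point of [0, 1[ by repeatedly subdividing it in proportion to the weights q  *)

Section choices.
Context (R : realType) (r N : nat).
Variables (q : 'I_N.+1 -> R) (upd : 'rV[int]_r -> 'I_N.+1 -> 'rV[int]_r).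
Hypothesis q_ge0 : forall i, 0 <= q i.
Hypothesis q_sum1 : \sum_i q i = 1.

Let F (i : nat) : R := \sum_(j < N.+1 | (j < i)%N) q j.

Let F0 : F 0 = 0.
Proof. by rewrite /F big_pred0. Qed.

Let FS (i : 'I_N.+1) : F i.+1 = F i + q i.
Proof.
rewrite /F (bigD1 i)//= addrC; congr (_ + _); apply: eq_bigl => j.
by rewrite ltnS andbC -ltn_neqAle.
Qed.

Let F1 : F N.+1 = 1.
Proof. by rewrite /F -q_sum1; apply: eq_bigl => j; rewrite ltn_ord. Qed.

Let F_le i j : (i <= j)%N -> F i <= F j.
Proof.
move=> ij; rewrite /F [leRHS](bigID (fun k : 'I_N.+1 => (k < i)%N))/=.
rewrite [X in _ <= X + _](eq_bigl (fun k : 'I_N.+1 => (k < i)%N)); last first.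
  by move=> k /=; apply: andb_idl => /leq_trans; apply.
by rewrite lerDl sumr_ge0.
Qed.

Let idx (w : R) : 'I_N.+1 := odflt ord0 [pick i : 'I_N.+1 | F i <= w < F i.+1].

Let idxP w i : F i <= w < F i.+1 -> forall j : 'I_N.+1, (i = j :> nat) -> idx w = j.
Proof.
move=> /andP[Fiw wFi] j ij; rewrite /idx; case: pickP => [k /andP[Fkw wFk]|/(_ j)].
  apply/val_inj => /=; rewrite -ij; apply/eqP; rewrite eqn_leq.
  apply/andP; split; rewrite leqNgt; apply/negP => /F_le.
    by rewrite leNgt (le_lt_trans Fkw wFi).
  by rewrite leNgt (le_lt_trans Fiw wFk).
by rewrite -ij Fiw wFi.
Qed.

Let idx_ex w : 0 <= w < 1 -> F (idx w) <= w < F (idx w).+1.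
Proof.
move=> /andP[w0 w1]; rewrite /idx; case: pickP => //= noi.
suff H i : (i <= N.+1)%N -> F i <= w.
  by have := H _ (leqnn _); rewrite F1 leNgt w1.
elim: i => [|i IH] iN; first by rewrite F0.
by have := noi (Ordinal iN); rewrite /= IH 1?ltnW//= => /negbT; rewrite -leNgt.
Qed.

Let nxt w := (w - F (idx w)) / q (idx w).

Let Fixpoint walk (z : 'rV[int]_r) (w : R) (k : nat) : 'rV[int]_r :=
  if k is k'.+1 then walk (upd z (idx w)) (nxt w) k' else z.

Let mkseq_walk z w k :
  mkseq (walk z w) k.+1 = z :: mkseq (walk (upd z (idx w)) (nxt w)) k.
Proof. by rewrite /mkseq /= -[1%N]/(1 + 0)%N iotaDl -map_comp. Qed.

Let Fixpoint ppr (z : 'rV[int]_r) (s : seq 'rV[int]_r) : R :=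
  if s is y :: s' then (y == z)%:R * \sum_i q i * ppr (upd z i) s' else 1.

Let A (a b : R) z s : set R :=
  [set w | b <= w < b + a /\ mkseq (walk z ((w - b) / a)) (size s) = s].

Let A_step a b z s : 0 <= a ->
  A a b z (z :: s) =
  \big[setU/set0]_(i < N.+1) A (a * q i) (b + a * F i) (upd z i) s.
Proof.
rewrite le_eqVlt => /predU1P[<-|a0].
  rewrite big1; last first.
    move=> i _; apply/seteqP; split => // w [] /andP[].
    by rewrite !mul0r !addr0 => /le_lt_trans h /h; rewrite ltxx.
  apply/seteqP; split => // w [] /andP[].
  by rewrite !addr0 => /le_lt_trans h /h; rewrite ltxx.
have aN0 : a != 0 by rewrite gt_eqF.
rewrite -bigcup_mkord_ord; apply/seteqP; split => [w [bw]|w].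
  rewrite mkseq_walk => -[ws].
  set u := (w - b) / a in ws *.
  have wE : w = b + a * u by rewrite /u mulrC divfK// addrC subrK.
  have /idx_ex : 0 <= u < 1.
    by move: bw; rewrite wE lerDl ltrD2l pmulr_rge0// -{2}[a]mulr1 ltr_pM2l.
  rewrite FS => /andP[Fu uF].
  exists (idx u : nat); [exact: ltn_ord|rewrite inord_val; split].
    by rewrite wE -addrA -mulrDr lerD2l ltrD2l ler_pM2l// ltr_pM2l// Fu uF.
  rewrite -[RHS]ws; congr (mkseq (walk _ _) _).
  by rewrite wE /nxt opprD addrACA subrr add0r -mulrBr -mulf_div divff// mul1r.
move=> [i /= iN]; set k : 'I_N.+1 := inord i => -[/andP[bw wb] ws].
have qk0 : 0 < q k.
  rewrite lt_neqAle q_ge0 andbT eq_sym; apply/eqP => qk0.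
  by move: (le_lt_trans bw wb); rewrite qk0 mulr0 addr0 ltxx.
pose u := (w - b) / a.
have wE : w = b + a * u by rewrite /u mulrC divfK// addrC subrK.
have Fu : F k <= u by move: bw; rewrite wE lerD2l ler_pM2l.
have uF : u < F k + q k.
  by move: wb; rewrite wE -addrA -mulrDr ltrD2l ltr_pM2l.
have idxu : idx u = k by apply: (@idxP u k) => //; rewrite FS Fu.
have u0 : 0 <= u by rewrite (le_trans _ Fu)// -F0 F_le.
have u1 : u < 1 by rewrite (lt_le_trans uF)// -FS -F1 F_le.
split.
  by rewrite wE lerDl ltrD2l pmulr_rge0// u0 -{2}[a]mulr1 ltr_pM2l.
rewrite mkseq_walk -/u idxu; congr (_ :: _); rewrite -[RHS]ws.
congr (mkseq (walk _ _) _); rewrite wE /nxt idxu.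
by rewrite opprD addrACA subrr add0r -mulrBr -mulf_div divff// mul1r.
Qed.

Let A_triv a b z s : 0 <= a ->
  trivIset [set: 'I_N.+1] (fun i => A (a * q i) (b + a * F i) (upd z i) s).
Proof.
move=> a0; apply/trivIsetP => /= i j _ _ ij; apply/seteqP; split => // w.
wlog : i j ij / (i < j)%N.
  move=> H [Ai Aj]; case: (ltngtP i j) => [lij|lji|/val_inj eij].
  - exact: (H _ _ ij lij).
  - by rewrite eq_sym in ij; exact: (H _ _ ij lji).
  - by rewrite eij eqxx in ij.
move=> /F_le lij [] [/andP[_ wi] _] [/andP[wj _] _].
have h : b + a * F i + a * q i <= b + a * F j.
  by rewrite -addrA -mulrDr lerD2l ler_wpM2l// -FS.
by have := lt_le_trans wi (le_trans h wj); rewrite ltxx.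
Qed.

Let A_measure s : forall z a b, 0 <= a ->
  measurable (A a b z s : set (measurableTypeR R)) /\
  lebesgue_measure (A a b z s) = (a * ppr z s)%:E.
Proof.
elim: s => [|y s IH] z a b a0.
  have -> : A a b z [::] = `[b, (b + a)%R[%classic.
    by apply/seteqP; split => w /=; rewrite in_itv/= => // -[].
  split; first exact: measurable_itv.
  rewrite lebesgue_measure_itv/= lte_fin mulr1 ltrDl; case: ltP => ha.
    by rewrite -EFinB addrAC subrr add0r.
  by congr EFin; apply/eqP; rewrite eq_le a0 ha.
have [->|yz] := eqVneq y z; last first.
  have -> : A a b z (y :: s) = set0.
    by apply/seteqP; split => // w [_]; rewrite mkseq_walk => -[/esym/eqP]; rewrite (negbTE yz).
  by rewrite measure0 /= (negbTE yz) mul0r mulr0; split => //; exact: measurable0.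
rewrite A_step//= eqxx mul1r; split.
  by apply: bigsetU_measurable => i _; apply: (IH _ _ _ _).1; rewrite mulr_ge0.
rewrite measure_semi_additive_ord; last 1 first.
- by apply: bigsetU_measurable => i _; apply: (IH _ _ _ _).1; rewrite mulr_ge0.
- rewrite mulr_sumr -sumEFin; apply: eq_bigr => i _.
  have [_ e] := IH (upd z i) (a * q i) (b + a * F i) (mulr_ge0 a0 (q_ge0 i)).
  by rewrite mulrA; exact: e.
- by move=> i; apply: (IH _ _ _ _).1; rewrite mulr_ge0.
- exact: A_triv.
Qed.

Variable x0 : 'rV[int]_r.

Let X (w : measurableTypeR R) : runs r := walk x0 w.

Let I01 : set (measurableTypeR R) := `[0%R, 1%R[%classic.

Let A01 s : X @^-1` cylinder s `&` I01 = A 1 0 x0 s.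
Proof.
apply/seteqP; split => w /=; rewrite /I01 /= in_itv/= /A/= add0r subr0 divr1.
  by case.
by case.
Qed.

Let mI01 : measurable I01. Proof. exact: measurable_itv. Qed.

Let mX : measurable_fun I01 X.
Proof.
apply: (@measurability _ _ _ (runs r) _ _ (@cylinders r)) => // B [C [s _ <-] <-].
by rewrite setIC A01; exact: (A_measure _ _ _ _).1.
Qed.

Let law (B : set (runs r)) : \bar R := lebesgue_measure (I01 `&` X @^-1` B).

Let law0 : law set0 = 0%E.
Proof. by rewrite /law preimage_set0 setI0 measure0. Qed.

Let law_ge0 B : (0 <= law B)%E. Proof. exact: measure_ge0. Qed.

Let law_sigma_additive : semi_sigma_additive law.
Proof.
move=> B mB tB mUB; rewrite /law preimage_bigcup setI_bigcupr.
apply: measure_semi_sigma_additive.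
- by move=> k; exact: mX.
- apply/trivIsetP => /= i j _ _ ij; apply/seteqP; split => // w [[_ Bi] [_ Bj]].
  have /seteqP[+ _] := trivIsetP.1 tB i j Logic.I Logic.I ij.
  by move=> /(_ (X w)); apply.
- by rewrite -setI_bigcupr -preimage_bigcup; exact: mX.
Qed.

Let law_setT : law [set: runs r] = 1%E.
Proof.
by rewrite /law preimage_setT setIT lebesgue_measure_itv/= lte_fin ltr01 sube0.
Qed.

Let ppr_trans (t : 'rV[int]_r -> 'rV[int]_r -> R) :
  (forall z z', t z z' = \sum_(i | z' == upd z i) q i) ->
  forall s z, \sum_i q i * ppr (upd z i) s =
    (fix pp z s := if s is z' :: s' then t z z' * pp z' s' else 1) z s.
Proof.
move=> tE; elim => [|y s IH] z.
  by under eq_bigr do rewrite mulr1.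
rewrite tE mulr_suml [RHS]big_mkcond/=; apply: eq_bigr => i _.
case: eqVneq => [->|_]; first by rewrite mul1r IH.
by rewrite mul0r mulr0.
Qed.

Lemma choices_law (t : 'rV[int]_r -> 'rV[int]_r -> R) :
  (forall z z', t z z' = \sum_(i | z' == upd z i) q i) ->
  exists mu : probability (runs r) R, forall z s, mu (cylinder (z :: s)) =
    ((z == x0)%:R *
     (fix pp z s := if s is z' :: s' then t z z' * pp z' s' else 1) z s)%:E.
Proof.
move=> tE.
pose mu : {measure set (runs r) -> \bar R} := HB.pack_for
  {measure set (runs r) -> \bar R} law
  (isMeasure.Build _ _ _ law law0 law_ge0 law_sigma_additive).
pose pmu : probability (runs r) R := HB.pack_for (probability (runs r) R)
  (Measure.sort mu) (Measure_isProbability.Build _ _ _ mu law_setT).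
exists pmu => z s.
rewrite /= /law setIC A01 (A_measure _ _ _ _).2// mul1r /=.
by case: eqVneq => [->|_]; rewrite ?mul0r// (ppr_trans tE).
Qed.

End choices.

Section run_measure.
Context (R : realType) (r n : nat) (P : cp_program R r n).

Lemma induced_exists (x0 : 'rV[int]_r) :
  exists mu : probability (runs r) R, induced P x0 mu.
Proof.
pose q (i : 'I_n.+1) := oapp (cp_p P) (cp_p' P) (unlift ord0 i).
pose upd z (i : 'I_n.+1) :=
  if guard P z then oapp (fun j => z + cp_c P j) (cp_d P) (unlift ord0 i) else z.
have q_ge0 i : 0 <= q i.
  by rewrite /q; case: unlift => [j|] /=; [exact: cp_p_ge0|exact: cp_p'_ge0].
have q_sum1 : \sum_i q i = 1.
  rewrite big_ord_recl /q unlift_none /= addrC -[RHS](cp_p_sum1 P); congr (_ + _).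
  by apply: eq_bigr => j _; rewrite liftK.
have tE z z' : trans P z z' = \sum_(i | z' == upd z i) q i.
  rewrite /trans /upd; case: (guard P z) => /=.
    rewrite [RHS]big_mkcond/= big_ord_recl /q unlift_none /= addrC; congr (_ + _).
      by rewrite [LHS]big_mkcond; apply: eq_bigr => j _; rewrite liftK.
    by have [_|_] := eqVneq z' (cp_d P); rewrite ?mul1r ?mul0r.
  have [_|_] := eqVneq z' z; first by rewrite q_sum1.
  by rewrite big_pred0.
have [mu muE] := choices_law q_ge0 q_sum1 x0 tE.
by exists mu => z s; rewrite muE; congr (_ * _)%:E; elim: s z {muE} => //= y s IH z; rewrite IH.
Qed.

Definition run_measure (x0 : 'rV[int]_r) : probability (runs r) R :=
  projT1 (cid (induced_exists x0)).

Lemma run_measureP (x0 : 'rV[int]_r) : induced P x0 (run_measure x0).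
Proof. exact: projT2 (cid (induced_exists x0)). Qed.

Lemma induced_unique (x0 : 'rV[int]_r) (mu nu : probability (runs r) R) :
  induced P x0 mu -> induced P x0 nu ->
  forall B : set (runs r), measurable B -> mu B = nu B.
Proof.
move=> muP nuP B mB.
pose G : set (set (runs r)) := @cylinders r `|` [set set0].
have GI : setI_closed G.
  move=> _ _ [[s _ <-]|->] [[t _ <-]|->]; rewrite ?set0I ?setI0; try by right.
  wlog st : s t / (size s <= size t)%N => [H|].
    by have [/H//|/ltnW/H] := leqP (size s) (size t); rewrite setIC.
  have cylS (w : run r) : cylinder t w -> (cylinder s w <-> take (size s) t = s).
    rewrite /cylinder /= => tw.
    suff -> : mkseq w (size s) = take (size s) t by [].
    by rewrite -[in RHS]tw -map_take take_iota (minn_idPl st).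
  have [ts|ts] := pselect (take (size s) t = s).
    left; exists t => //; apply/seteqP; split => [w tw|w []//].
    by split => //; apply/(cylS _ tw).
  right; apply/seteqP; split => // w [sw tw]; apply: ts.
  exact/(cylS _ tw).
have mE : measurable = <<s G >> :> set (set (runs r)).
  apply/seteqP; split; apply: smallest_sub.
  - exact: smallest_sigma_algebra.
  - by move=> C cC; apply: sub_sigma_algebra; left.
  - exact: (@sigma_algebra_measurable _ (runs r)).
  - by move=> C [cC|->]; [exact: sub_sigma_algebra|exact: measurable0].
apply: (@measure_unique _ R (runs r) G (fun=> setT)) => //.
- by move=> _; left; exists [::] => //; apply/seteqP; split.
- by rewrite bigcup_const.
- move=> C [[[|z s] _ <-]|->]; last by rewrite !measure0.
    have -> : cylinder [::] = [set: runs r] by apply/seteqP; split.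
    exact: etrans (probability_setT mu) (esym (probability_setT nu)).
  exact: etrans (muP z s) (esym (nuP z s)).
- by move=> _; rewrite (le_lt_trans (probability_le1 _ _))// ltry.
Qed.

End run_measure.

Section runtime.
Context (R : realType) (r n : nat) (P : cp_program R r n).

(* the value None stands for infinity *)
Definition term_time (w : runs r) : option nat :=
  if pselect (exists k, ~~ guard P (w k)) is left ex then Some (ex_minn ex)
  else None.

Definition ereal_of_time (t : option nat) : \bar R :=
  if t is Some k then (k%:R)%:E else +oo%E.

Definition expected_time (x0 : 'rV[int]_r) : \bar R :=
  (\int[run_measure P x0]_w ereal_of_time (term_time w))%E.

Definition prob_term (x0 : 'rV[int]_r) : \bar R :=
  run_measure P x0 [set w | term_time w <> None].

Definition rt (x0 : 'rV[int]_r) : \bar R :=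
  if prob_term x0 == 1%E then expected_time x0 else +oo%E.

End runtime.

Section rdw.
Context (R : realType) (r n : nat) (P : cp_program R r n).

Definition rdw (z : 'rV[int]_r) : int := sprod (cp_a P) z - cp_b P.

Definition drift (j : 'I_n) : int := sprod (cp_a P) (cp_c P j).

Lemma kP_exists : exists k : nat, [forall j, - k%:Z <= drift j].
Proof.
exists (\max_j `|drift j|)%N; apply/forallP => j.
have : (`|drift j| <= \max_j `|drift j|)%N by exact: leq_bigmax.
by rewrite -lez_nat abszE; have := ler_norm (- drift j); rewrite normrN; lra.
Qed.

Lemma mP_exists : exists m : nat, [forall j, drift j <= m%:Z].
Proof.
exists (\max_j `|drift j|)%N; apply/forallP => j.
have : (`|drift j| <= \max_j `|drift j|)%N by exact: leq_bigmax.
by rewrite -lez_nat abszE; have := ler_norm (drift j); lra.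
Qed.

Definition kP : nat := ex_minn kP_exists.

Definition mP : nat := ex_minn mP_exists.

Definition p_rdw (j : int) : R :=
  \sum_(u < n | drift u == j) cp_p P u.

(* the integers j with - kP <= j <= mP are enumerated as i - kP, i < kP + mP + 1 *)
Definition rdw_jump (i : 'I_(kP + mP).+1) : int := i%:Z - kP%:Z.

Lemma rdw_jump_inj :
  injective (fun i => const_mx (rdw_jump i) : 'rV[int]_1).
Proof.
move=> i j /matrixP/(_ 0 0); rewrite !mxE => /addIr [].
exact: val_inj.
Qed.

Lemma rdw_exit :
  sprod (const_mx 1) (const_mx (rdw (cp_d P)) : 'rV[int]_1) <= 0.
Proof. by rewrite /sprod big_ord1 !mxE mul1r subr_le0 cp_d_exit. Qed.

Lemma p_rdw_ge0 (j : int) : 0 <= p_rdw j.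
Proof. by apply: sumr_ge0 => u _; exact: cp_p_ge0. Qed.

Lemma p_rdw_sum1 : \sum_(i < (kP + mP).+1) p_rdw (rdw_jump i) + cp_p' P = 1.
Proof.
rewrite -[RHS](cp_p_sum1 P); congr (_ + _).
have /= kd u : - kP%:Z <= drift u.
  by rewrite /kP; case: ex_minnP => k /forallP.
have /= md u : drift u <= mP%:Z.
  by rewrite /mP; case: ex_minnP => m /forallP.
rewrite [RHS](partition_big
  (fun u => inord (absz (drift u + kP%:Z)) : 'I_(kP + mP).+1) predT)//=.
apply: eq_bigr => i _; apply: eq_bigl => u.
have dk : 0 <= drift u + kP%:Z by rewrite -lerBlDr sub0r.
have dE : (absz (drift u + kP%:Z))%:Z = drift u + kP%:Z by rewrite gez0_abs.
have lt : (absz (drift u + kP%:Z)%R < (kP + mP).+1)%N.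
  by rewrite ltnS -lez_nat dE PoszD addrC lerD2l.
rewrite -val_eqE /= inordK// -eqz_nat dE /rdw_jump.
by rewrite -subr_eq opprK.
Qed.

Definition rdw_program : cp_program R 1 (kP + mP).+1 :=
  @CPProgram R 1 (kP + mP).+1 (const_mx 1) 0
    (fun i => const_mx (rdw_jump i)) (const_mx (rdw (cp_d P)))
    (fun i => p_rdw (rdw_jump i)) (cp_p' P)
    rdw_jump_inj rdw_exit (fun i => p_rdw_ge0 (rdw_jump i)) (cp_p'_ge0 P)
    p_rdw_sum1.

End rdw.

(* Main.v *)
(** Reading a run of [P] through [rdw P] turns it into a run of the random walk
    program: the loop guard and every transition probability depend on a state
    [z] only through [rdw P z], so the process is lumpable.  Hence the image of
    the run measure of [P] has the cylinder probabilities that characterise the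
    run measure of the random walk program.  Since the map preserves termination
    times, their laws and expectations agree.  A positive probability of
    divergence makes the expectation infinite, so that the case distinction in
    the expected runtime is vacuous. *)

Require Import Defs.
From HB Require Import structures.
From mathcomp Require Import all_boot all_order all_algebra.
From mathcomp Require Import all_classical all_reals all_analysis.
From mathcomp Require Import measurable_realfun.

Import Order.TTheory GRing.Theory Num.Theory.

Local Open Scope classical_set_scope.
Local Open Scope ring_scope.

(** * Sums over countable state spaces *)

Section countable_sums.
Context {R : realType}.

Lemma esum_delta (T : choiceType) (a : T) (g : T -> R) : 0 <= g a ->
  \esum_(z in [set: T]) ((z == a)%:R * g z)%:E = (g a)%:E.
Proof.
move=> ga0; rewrite -[RHS](@esum_set1 _ _ a (fun z => (g z)%:E)) ?lee_fin//.
rewrite [RHS]esum_mkcond; apply: eq_esum => z _.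
have [->|za] := eqVneq z a; first by rewrite mul1r mem_set.
by rewrite mul0r memNset// => /= e; rewrite e eqxx in za.
Qed.

(** Countable additivity along the fibres of [X]. It serves below to split an event according to the
    exact state of the run at a given time. *)
Lemma measure_esum_fibers (d : measure_display) (T : measurableType d)
    (U : countType) (mu : {measure set T -> \bar R}) (X : T -> U) (A : set T) :
  (forall z, measurable (A `&` X @^-1` [set z])) ->
  mu A = \esum_(z in [set: U]) mu (A `&` X @^-1` [set z]).
Proof.
move=> mX.
pose D := range (@pickle U).
(* The fibres become a sequence of sets through [pickle]; numbers that code no element get the empty
   set. *)
pose F n := if @pickle_inv U n is Some z then A `&` X @^-1` [set z] else set0.
have FE z : F (pickle z) = A `&` X @^-1` [set z] by rewrite /F pickleK_inv.
have mF n : measurable (F n) by rewrite /F; case: pickle_inv.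
(* The default [X point] only makes decoding total: on [D] the inverse always succeeds. *)
rewrite (reindex_esum D [set: U] (fun n => odflt (X point) (pickle_inv n))); last first.
  split => //.
    by move=> _ _ /set_mem[x _ <-] /set_mem[y _ <-]; rewrite !pickleK_inv /= => ->.
  by move=> z _; exists (pickle z); [exists z|rewrite pickleK_inv].
rewrite -[in LHS](_ : \bigcup_(n in D) F n = A); last first.
  apply/seteqP; split => [w [_ [z _ <-]]|w Aw]; first by rewrite FE => -[].
  by exists (pickle (X w)); [exists (X w)|rewrite FE].
rewrite measure_bigcup//; last first.
  move=> _ _ [x _ <-] [y _ <-]; rewrite !FE => -[w [[_ /= <-] [_ /= <-]]].
  by [].
rewrite nneseries_esum//.
rewrite (_ : [set n | n \in D] = D); last by apply/seteqP; split => k /= /[!inE].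
by apply: eq_esum => _ [z _ <-]; rewrite FE pickleK_inv.
Qed.

End countable_sums.

(** * Measurability of events on runs *)

Section run_events.
Context {r : nat}.

Lemma measurable_cylinder (s : seq 'rV[int]_r) :
  measurable (cylinder s : set (runs r)).
Proof. by apply: sub_sigma_algebra; exists s. Qed.

(** There are only countably many prefixes of length [m], so [A] is the countable union of the
    cylinders over the prefixes of its own runs. *)
Lemma measurable_prefix_event (m : nat) (A : set (runs r)) :
  (forall w w' : run r, (forall i, (i < m)%N -> w i = w' i) -> A w -> A w') ->
  measurable A.
Proof.
move=> mA.
rewrite (_ : A = \bigcup_(s in [set: seq 'rV[int]_r])
  if `[< exists2 w : run r, A w & mkseq w m = s >] then cylinder s else set0).
  apply: countable_bigcupT_measurable => // s; case: ifP => // _.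
  exact: measurable_cylinder.
apply/seteqP; split => [w Aw|w [s _]].
  exists (mkseq w m) => //; case: asboolP => [_|[]]; last by exists w.
  by rewrite /cylinder /= size_mkseq.
case: asboolP => // -[w' Aw' <-]; rewrite /cylinder /= size_mkseq => e.
apply: mA Aw' => i im.
by rewrite -(nth_mkseq 0 w' im) -e nth_mkseq.
Qed.

Lemma measurable_coordinate (k : nat) (Q : set 'rV[int]_r) :
  measurable [set w : runs r | Q (w k)].
Proof. by apply: (@measurable_prefix_event k.+1) => w w' /= ->. Qed.

End run_events.

(** * The termination time and the expected runtime *)

Section termination.
Context {R : realType} {r n : nat} (P : cp_program R r n).

Lemma term_time_SomeP (w : runs r) (k : nat) :
  term_time P w = Some k <->
  ~~ guard P (w k) /\ forall i, (i < k)%N -> guard P (w i).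
Proof.
rewrite /term_time; case: pselect => [ex|nex]; last first.
  by split => // -[gk _]; exfalso; apply: nex; exists k.
case: ex_minnP => m gm mmin; split => [[<-]|[gk gi]].
  by split => // i im; apply: contraTT im => /mmin; rewrite -leqNgt.
congr Some; apply/eqP; rewrite eqn_leq mmin//= leqNgt.
by apply/negP => /gi; exact/negP.
Qed.

Lemma term_time_NoneP (w : runs r) :
  term_time P w = None <-> forall k, guard P (w k).
Proof.
rewrite /term_time; case: pselect => [ex|nex]; split => //.
  by move=> gw; exfalso; case: ex => k; rewrite gw.
by move=> _ k; apply/negPn/negP => gk; apply: nex; exists k.
Qed.

(** Since [option nat] is countable, single values suffice. Time [k] is decided by the states [0] to
    [k], hence a prefix of length [k.+1]; divergence is a countable intersection of guard
    conditions. *)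
Lemma measurable_term_time (J : set (option nat)) :
  measurable [set w : runs r | J (term_time P w)].
Proof.
have m1 j : measurable [set w : runs r | term_time P w = j].
  case: j => [k|].
    apply: (@measurable_prefix_event _ k.+1) => w w' ww' /term_time_SomeP[gk gi].
    apply/term_time_SomeP; split; first by rewrite -ww'.
    by move=> i ik; rewrite -ww' ?gi// ltnW.
  rewrite (_ : [set _ | _] = \bigcap_k [set w : runs r | guard P (w k)]).
    by apply: bigcapT_measurable => k; exact: (measurable_coordinate k (guard P)).
  apply/seteqP; split => [w /term_time_NoneP gw k _|w gw] /=; first exact: gw.
  by apply/term_time_NoneP => k; exact: gw.
rewrite (_ : [set _ | _] = \bigcup_(j in [set: option nat])
  if `[< J j >] then [set w : runs r | term_time P w = j] else set0).
  by apply: countable_bigcupT_measurable => // j; case: ifP.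
apply/seteqP; split => [w Jw|w [j _]].
  by exists (term_time P w) => //; case: asboolP.
by case: asboolP => // Jj /= ->.
Qed.

Lemma measurable_fun_term_time :
  measurable_fun [set: runs r] (ereal_of_time R \o term_time P).
Proof.
by move=> _ B _; rewrite setTI; exact: measurable_term_time (ereal_of_time R @^-1` B).
Qed.

Lemma ereal_of_time_ge0 (t : option nat) : (0 <= ereal_of_time R t)%E.
Proof. by case: t => [k|] /=; rewrite ?lee_fin// leey. Qed.

Lemma rtE (x0 : 'rV[int]_r) : rt P x0 = expected_time P x0.
Proof.
rewrite /rt; case: ifPn => // pN1; apply/esym/eqP; rewrite -leye_eq.
pose N := [set w : runs r | term_time P w = None].
have mN : measurable N by exact: measurable_term_time [set None].
have muN : (0 < run_measure P x0 N)%E.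
  rewrite lt_neqAle measure_ge0 andbT eq_sym; apply: contra pN1 => /eqP N0.
  rewrite /prob_term -[X in run_measure P x0 X]/(~` N) probability_setC//.
  by rewrite N0 sube0.
(* The integrand is [+oo] on the divergence event [N], which has positive measure, so the part of
   the integral over [N] is already infinite. *)
have -> : (+oo = \int[run_measure P x0]_(w in N) ereal_of_time R (term_time P w))%E.
  rewrite (eq_integral (cst +oo%E)); last by move=> w /set_mem /= ->.
  by rewrite integral_cst// gt0_mulye.
apply: ge0_subset_integral => //; first exact: measurable_fun_term_time.
by move=> w _; exact: ereal_of_time_ge0.
Qed.

End termination.

(** * Transition and path probabilities *)

Section markov.
Context {R : realType} {r n : nat} (P : cp_program R r n).

Lemma trans_ge0 (z z' : 'rV[int]_r) : 0 <= trans P z z'.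
Proof.
rewrite /trans; case: ifP => _ //; rewrite addr_ge0 ?mulr_ge0 ?cp_p'_ge0//.
by apply: sumr_ge0 => j _; exact: cp_p_ge0.
Qed.

Lemma path_prob_ge0 (s : seq 'rV[int]_r) : forall z, 0 <= path_prob P z s.
Proof. by elim: s => //= y s IH z; rewrite mulr_ge0// trans_ge0. Qed.

Lemma path_prob_rcons (s : seq 'rV[int]_r) (z z' : 'rV[int]_r) :
  path_prob P z (rcons s z') = path_prob P z s * trans P (last z s) z'.
Proof. by elim: s z => [|y s IH] z /=; rewrite ?mulr1 ?mul1r// IH mulrA. Qed.

(** The expectation of [g] after one step. The transition law is a weighted sum of point masses, one
    per update, so updates that lead to the same state need no separate treatment. *)
Lemma esum_trans (z : 'rV[int]_r) (g : 'rV[int]_r -> R) :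
  (forall z', 0 <= g z') ->
  \esum_(z' in [set: 'rV[int]_r]) (trans P z z' * g z')%:E =
  (if guard P z then \sum_(j < n) cp_p P j * g (z + cp_c P j) + cp_p' P * g (cp_d P)
   else g z)%:E.
Proof.
move=> g0; rewrite /trans; case: ifP => _; last exact: esum_delta.
have p0 := cp_p_ge0 P; have p'0 := cp_p'_ge0 P.
rewrite (@eq_esum _ _ _ _ (fun z' =>
  (\sum_(j < n) ((z' == z + cp_c P j)%:R * (cp_p P j * g z'))%:E +
   ((z' == cp_d P)%:R * (cp_p' P * g z'))%:E)%E)); last first.
  move=> z' _; rewrite mulrDl EFinD mulrA sumEFin; congr (_%:E + _)%E.
  rewrite mulr_suml big_mkcond/=; apply: eq_bigr => j _.
  by case: eqP; rewrite ?mul1r ?mul0r.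
rewrite esumD; last 2 first.
- by move=> z' _; apply: sume_ge0 => j _; rewrite lee_fin !mulr_ge0.
- by move=> z' _; rewrite lee_fin !mulr_ge0.
rewrite esum_sum; last by move=> z' j _ _; rewrite lee_fin !mulr_ge0.
rewrite EFinD (esum_delta _ _ (fun z' => cp_p' P * g z')) ?mulr_ge0// -sumEFin.
congr (_ + _)%E; apply: eq_bigr => j _.
by rewrite (esum_delta _ _ (fun z' => cp_p P j * g z'))// mulr_ge0.
Qed.

End markov.

(** * Lumping the runs of [P] onto the random walk *)

Section lumping.
Context {R : realType} {r n : nat} (P : cp_program R r n).

Let Q := rdw_program P.

Definition rdw_state (z : 'rV[int]_r) : 'rV[int]_1 := const_mx (rdw P z).

Definition rdw_run (w : runs r) : runs 1 := fun k => rdw_state (w k).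

Lemma sprodDr (u v v' : 'rV[int]_r) : sprod u (v + v') = sprod u v + sprod u v'.
Proof. by rewrite /sprod -big_split; apply: eq_bigr => i _; rewrite mxE mulrDr. Qed.

Lemma rdw_stateD (z : 'rV[int]_r) (j : 'I_n) :
  rdw_state (z + cp_c P j) = rdw_state z + const_mx (drift P j).
Proof.
by apply/rowP => i; rewrite !mxE /rdw /drift sprodDr addrAC.
Qed.

Lemma guard_rdw (z : 'rV[int]_r) : guard Q (rdw_state z) = guard P z.
Proof. by rewrite /guard /= /sprod big_ord1 !mxE mul1r subr_gt0. Qed.

(** This ensures that no update is lost when updates are regrouped by drift; the index is the drift
    shifted by [kP P]. *)
Lemma drift_is_jump (u : 'I_n) : exists i : 'I_(kP P + mP P).+1, drift P u = rdw_jump i.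
Proof.
have kd : - (kP P)%:Z <= drift P u by rewrite /kP; case: ex_minnP => k /forallP.
have md : drift P u <= (mP P)%:Z by rewrite /mP; case: ex_minnP => m /forallP.
have dk : 0 <= drift P u + (kP P)%:Z by rewrite -lerBlDr sub0r.
have lt : (absz (drift P u + (kP P)%:Z)%R < (kP P + mP P).+1)%N.
  by rewrite ltnS -lez_nat gez0_abs// PoszD addrC lerD2l.
by exists (Ordinal lt); rewrite /rdw_jump /= gez0_abs// addrK.
Qed.

(** Lumpability: the right-hand side is the total probability that [P] moves from [z] into the class
    of states with image [y]. *)
Lemma rdw_transE (z : 'rV[int]_r) (y : 'rV[int]_1) :
  trans Q (rdw_state z) y =
  if guard P z then \sum_(j < n) cp_p P j * (rdw_state (z + cp_c P j) == y)%:R +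
                    cp_p' P * (rdw_state (cp_d P) == y)%:R
  else (rdw_state z == y)%:R.
Proof.
rewrite /trans guard_rdw; case: ifP => _; last by rewrite eq_sym.
rewrite mulrC [y == _]eq_sym; congr (_ + _).
(* Each [p_rdw] is unfolded into the updates of that drift. After the exchange of sums, every update
   meets exactly one jump index. *)
transitivity (\sum_(i < (kP P + mP P).+1) \sum_(u < n | drift P u == rdw_jump i)
                cp_p P u * (rdw_state (z + cp_c P u) == y)%:R).
  rewrite big_mkcond; apply: eq_bigr => i _ /=.
  rewrite (eq_bigr (fun u => cp_p P u *
    (y == rdw_state z + const_mx (rdw_jump i))%:R)); last first.
    by move=> u /eqP du; rewrite rdw_stateD du eq_sym.
  by rewrite -mulr_suml -/(p_rdw P _); case: eqP; rewrite ?mulr1 ?mulr0.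
rewrite (exchange_big_dep predT)//=; apply: eq_bigr => u _.
have [i di] := drift_is_jump u.
rewrite (big_pred1 i)// => i' /=; rewrite di; apply/eqP/eqP => [e|->//].
by apply: (@rdw_jump_inj _ _ _ P); rewrite e.
Qed.

Lemma measurable_rdw_run : measurable_fun [set: runs r] rdw_run.
Proof.
apply: (@measurability _ _ _ (runs 1) _ _ (@cylinders 1)) => // B [C [s _ <-] <-].
rewrite setTI; apply: (@measurable_prefix_event _ (size s)) => w w' ww' /= <-.
rewrite /cylinder /= size_mkseq; apply/esym/eq_in_map => i.
by rewrite mem_iota add0n => /= /ww' e; rewrite /rdw_run e.
Qed.

(** This makes [distribution mu rdw_run] available as a probability measure. *)
HB.instance Definition _ :=
  isMeasurableFun.Build _ _ _ _ rdw_run measurable_rdw_run.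

Lemma term_time_rdw (w : runs r) : term_time Q (rdw_run w) = term_time P w.
Proof.
case e : (term_time P w) => [k|].
  move/term_time_SomeP: e => [gk gi]; apply/term_time_SomeP.
  by rewrite guard_rdw; split => // i /gi; rewrite guard_rdw.
by move/term_time_NoneP: e => gw; apply/term_time_NoneP => k; rewrite guard_rdw.
Qed.

Variable x0 : 'rV[int]_r.

Let mu := run_measure P x0.

(** A cylinder of the random walk pulled back to runs of [P] and shifted to start at time [m]. The
    shift lets a prefix of exact states be followed by states known only through their images. *)
Definition rdw_reads (m : nat) (s : seq 'rV[int]_1) : set (runs r) :=
  [set w | [seq rdw_state (w i) | i <- iota m (size s)] = s].

Lemma measurable_rdw_reads (m : nat) (s : seq 'rV[int]_1) :
  measurable (rdw_reads m s).
Proof.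
apply: (@measurable_prefix_event _ (m + size s)) => w w' ww' /= e.
rewrite /rdw_reads /= -[RHS]e; apply/esym/eq_in_map => i.
by rewrite mem_iota => /andP[_ /ww' ->].
Qed.

Lemma cylinder_rcons (s : seq 'rV[int]_r) (z : 'rV[int]_r) :
  cylinder (rcons s z) = cylinder s `&` [set w : run r | w (size s) = z].
Proof.
apply/seteqP; rewrite /cylinder /=; split=> w /=;
  rewrite size_rcons /mkseq -[(size s).+1]addn1 iotaD map_cat /= cats1.
  by move/rcons_inj => [-> ->].
by case=> -> ->.
Qed.

(** Induction on [s] with the exact prefix generalized: conditioning on the next state [z] moves one
    entry from the readings to the prefix, and lumpability evaluates the sum over [z]. *)
Lemma measure_cylinder_reads (s : seq 'rV[int]_1) :
  forall (u : 'rV[int]_r) (t : seq 'rV[int]_r),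
  mu (cylinder (u :: t) `&` rdw_reads (size t).+1 s) =
  ((u == x0)%:R * path_prob P u t * path_prob Q (rdw_state (last u t)) s)%:E.
Proof.
elim: s => [|y s IH] u t.
  rewrite mulr1 -(run_measureP P x0 u t) -/mu; congr (mu _).
  by apply/seteqP; split => w; [case|].
have fiberE z : cylinder (u :: t) `&` rdw_reads (size t).+1 (y :: s) `&`
    (fun w : runs r => w (size t).+1) @^-1` [set z] =
    if rdw_state z == y
    then cylinder (u :: rcons t z) `&` rdw_reads (size (rcons t z)).+1 s else set0.
  rewrite -rcons_cons cylinder_rcons size_rcons.
  apply/seteqP; split => w.
    by move=> [[cw /= [<- rw]] /= wz]; rewrite wz eqxx; split.
  case: eqP => // zy [[cw /= wz] rw]; split => //; split => //=.
  by rewrite /rdw_reads /= wz zy; congr (_ :: _).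
rewrite (@measure_esum_fibers _ _ _ _ mu (fun w => w (size t).+1)); last first.
  move=> z; rewrite fiberE; case: ifP => // _.
  by apply: measurableI; [exact: measurable_cylinder|exact: measurable_rdw_reads].
(* The factor shared by all [z] with image [y]: by the induction hypothesis, the future depends on
   [z] only through [y]. *)
pose c := (u == x0)%:R * path_prob P u t * path_prob Q y s.
have c0 : 0 <= c by rewrite !mulr_ge0// path_prob_ge0.
transitivity (\esum_(z in [set: 'rV[int]_r])
    (trans P (last u t) z * ((rdw_state z == y)%:R * c))%:E).
  apply: eq_esum => z _; rewrite fiberE; case: eqP => [zy|_]; last first.
    by rewrite measure0 mul0r mulr0.
  apply: etrans (IH u (rcons t z)) _.
  rewrite path_prob_rcons last_rcons zy mul1r /c; congr (_%:E).
  by rewrite [RHS]mulrCA !mulrA.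
rewrite esum_trans; last by move=> z; rewrite mulr_ge0.
rewrite /= [in RHS]mulrCA -/c rdw_transE; congr (_%:E); case: ifP => // _.
rewrite mulrDl mulr_suml mulrA; congr (_ + _).
by apply: eq_bigr => j _; rewrite mulrA.
Qed.

(** The cylinder fixes only the image of the initial state, so it is split along the exact initial
    state, where [x0] carries all the mass. *)
Lemma rdw_run_induced : Defs.induced Q (rdw_state x0) (distribution mu rdw_run).
Proof.
move=> y s; rewrite -[LHS]/(mu (rdw_run @^-1` cylinder (y :: s))).
have fiberE z : rdw_run @^-1` cylinder (y :: s) `&`
    (fun w : runs r => w 0%N) @^-1` [set z] =
    if rdw_state z == y then cylinder [:: z] `&` rdw_reads 1 s else set0.
  apply/seteqP; split => w.
    move=> [/= [e rw] wz]; rewrite -e /rdw_run wz eqxx.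
    by split => //; rewrite -wz.
  case: eqP => // zy [[wz] rw]; split => //.
  by rewrite /preimage /cylinder /= -zy -wz; congr (_ :: _).
rewrite (@measure_esum_fibers _ _ _ _ mu (fun w => w 0%N)); last first.
  move=> z; rewrite fiberE; case: ifP => // _.
  by apply: measurableI; [exact: measurable_cylinder|exact: measurable_rdw_reads].
rewrite (@eq_esum _ _ _ _ (fun z =>
  ((z == x0)%:R * ((y == rdw_state z)%:R * path_prob Q y s))%:E)).
  by rewrite esum_delta// mulr_ge0// path_prob_ge0.
move=> z _; rewrite fiberE eq_sym; case: eqP => [->|_].
  by apply: etrans (measure_cylinder_reads s z [::]) _; rewrite /= mulr1 mul1r.
by rewrite measure0 mul0r mulr0.
Qed.

(** Both measures have the same cylinder probabilities, and these determine the measure. *)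
Lemma run_measure_rdw (B : set (runs 1)) : measurable B ->
  run_measure Q (rdw_state x0) B = mu (rdw_run @^-1` B).
Proof. exact: induced_unique (run_measureP _ _) rdw_run_induced B. Qed.

(** Change of variables along [rdw_run], which preserves the termination time. *)
Lemma expected_time_rdw : expected_time Q (rdw_state x0) = expected_time P x0.
Proof.
rewrite /expected_time (eq_measure_integral (distribution mu rdw_run)); last first.
  by move=> B mB _; exact: run_measure_rdw.
rewrite ge0_integral_distribution.
- by apply: eq_integral => w _ /=; rewrite term_time_rdw.
- exact: measurable_fun_term_time.
- by move=> w; exact: ereal_of_time_ge0.
Qed.

(** A general [J] covers both a single value of the time and termination in finite time. *)
Lemma term_time_law (J : set (option nat)) :
  run_measure Q (rdw_state x0) [set w | J (term_time Q w)] =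
  mu [set w | J (term_time P w)].
Proof.
rewrite run_measure_rdw; last exact: measurable_term_time.
by congr (mu _); apply/seteqP; split => w /=; rewrite term_time_rdw.
Qed.

End lumping.

Theorem theorem15 (R : realType) (r n : nat) (P : cp_program R r n)
    (x0 : 'rV[int]_r) (y0 : int) (hy0 : y0 = rdw P x0) :
  (forall j : option nat,
     run_measure P x0 [set w | term_time P w = j] =
     run_measure (rdw_program P) (const_mx y0)
       [set w | term_time (rdw_program P) w = j]) /\
  run_measure P x0 [set w | term_time P w <> None] =
    run_measure (rdw_program P) (const_mx y0)
      [set w | term_time (rdw_program P) w <> None] /\
  rt P x0 = expected_time P x0 /\
  expected_time P x0 = expected_time (rdw_program P) (const_mx y0) /\
  expected_time (rdw_program P) (const_mx y0) =
    rt (rdw_program P) (const_mx y0).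
Proof.
rewrite hy0 -/(rdw_state P x0) !rtE expected_time_rdw; do !split => //.
- by move=> j; rewrite (term_time_law P x0 [set j]).
- by rewrite (term_time_law P x0 [set j | j <> None]).
Qed.
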